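(* For every $0\le l\le L-1$, $$B_\delta^{(l),-1}=P_\delta^{(l)}B_\delta^{(l+1),-1}\Big(R_\delta^{(l)}-B_\delta^{(l+1)}Q_\delta^{(l)}\check R_\delta^{(l)}\Big)+Q_\delta^{(l)}\check R_\delta^{(l)},$$ where $B_\delta^{(l),-1}$ denotes the inverse of $B_\delta^{(l)}$.
   Context: **Mesh hierarchy.** $\Omega=[0,1]^2$ is divided uniformly into $I\times I$ square cells of width $h=1/I$ (level $0$, the finest), $I=2^L I^{(L)}$ with $I^{(L)}=O(1)$. For $0\le l\le L$, $\mathcal C^{(l)}$ is the set of cells of the uniform $I^{(l)}\times I^{(l)}$ mesh, $I^{(l)}=I/2^l$, so each cell of $\mathcal C^{(l)}$, $l\ge1$, is a union of $2\times2$ cells of $\mathcal C^{(l-1)}$. $\mathcal C=\mathcal C^{(0)}$. $\mathcal I=\mathcal I^{(0)}$ is the set of edges (interfaces) of level-$0$ cells; $\mathcal I^{(l)}\subset\mathcal I$ is the set of those level-$0$ edges lying on the boundary of some cell of $\mathcal C^{(l)}$. $\mathcal I_{\mathrm b}^{(l)}$ and $\mathcal I_{\mathrm{in}}^{(l)}$ are the edges of $\mathcal I^{(l)}$ lying on $\partial\Omega$, respectively in the interior of $\Omega$; $\mathcal I_{\mathrm b}=\mathcal I_{\mathrm b}^{(0)}$, $\mathcal I_{\mathrm{in}}=\mathcal I_{\mathrm{in}}^{(0)}$. Thus $\mathcal I^{(l)}\subset\mathcal I^{(l-1)}$. $\bar{\mathbf x}_{\mathfrak i}$ is the midpoint of $\mathfrak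 i$, $\bar{\mathbf x}_C$ the center of $C$; for a set $\mathcal S$ of edges, $\mathcal S\cap C$ denotes the edges of $\mathcal S$ contained in $C$. **Local basis functions.** Let $(c_m,s_m,\omega_m)_{m=1}^{4M}$ be a discrete ordinate set ($M$ directions in each quadrant, $c_m,s_m\ne0$), $K=(\kappa_{m,p})$ the discrete scattering matrix, $W=\mathrm{diag}(\omega_m)$, $D=\mathrm{diag}(c_m)$, $S=\mathrm{diag}(s_m)$. For $C\in\mathcal C$ let $\sigma_{T,C}$, $\sigma_{s,C}$ be the (constant, scaled) total and scattering cross sections on $C$, i.e. $\bar\sigma_T/\epsilon$ and $\bar\sigma_T/\epsilon-\epsilon\bar\sigma_a$, where $\epsilon\in(0,1]$ is the scaling parameter and $\bar\sigma_T,\bar\sigma_a$ are the cell averages of the total and absorption cross sections. Let $(\lambda_C^{(k)},\xi_C^{(k)})$, $1\le k\le4M$, be the eigenpairs of $D^{-1}[\frac{\sigma_{s,C}}{\sigma_{T,C}}KW-\mathrm{Id}]$ and, for $4M+1\le k\le8M$, those of $S^{-1}[\frac{\sigma_{s,C}}{\sigma_{T,C}}KW-\mathrm{Id}]$, with $\|\xi_C^{(k)}\|_\infty=1$, ordered so that the functions below decay away from the side at which they are centered. On $C$ put $\phi_C^k(x,y)=\xi_C^{(k)}\exp(\lambda_C^{(k)}\sigma_{T,C}(x-x_C^{(k)}))$ for $k\le4M$, where $x_C^{(k)}$ is the abscissa of the left side of $C$ for $k\le2M$ and of the right side for $k>2M$; and $\phi_C^k(x,y)=\xi_C^{(k)}\exp(\lambda_C^{(k)}\sigma_{T,C}(y-y_C^{(k)}))$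 for $k>4M$, where $y_C^{(k)}$ is the ordinate of the bottom side for $k\le6M$ and of the top side for $k>6M$. $\phi_C^k$ is extended by $0$ to the other cells. $\mathcal V_{C,\mathfrak i}$ is the set of the $2M$ indices $k$ for which $\phi_C^k$ is centered on the edge $\mathfrak i$ of $C$. **Selected indices.** For a threshold $\delta>0$: $\mathcal V_{\delta,C}=\{k\in\{1,\dots,8M\}:|\phi_C^k(\bar{\mathbf x}_C)|>\delta\}$ ($|\cdot|$ the sup norm), $\mathcal V_{\delta,C,\mathfrak i}=\mathcal V_{\delta,C}\cap\mathcal V_{C,\mathfrak i}$ for $C\in\mathcal C$, and $\mathcal V_{\delta,\mathfrak i}=\bigcup_{C\in\mathcal C,\ \mathfrak i\subset C}\mathcal V_{\delta,C,\mathfrak i}$ (indices of different cells being regarded as distinct). For $C\in\mathcal C^{(l)}$ put $\mathcal V_{\delta,C,\mathfrak i}=\bigcup_{C_0\in\mathcal C,\ C_0\subset C}\mathcal V_{\delta,C_0,\mathfrak i}$ (over $C_0$ having $\mathfrak i$ as edge). $\mathcal F_\delta$ is the real span of all $\phi_C^k$, $C\in\mathcal C$, $k\in\mathcal V_{\delta,C}$. For a cell $C$ of any level and an edge $\mathfrak i\subset\partial C$, $f(\bar{\mathbf x}_{\mathfrak i})|_C$ is the one-sided value from inside $C$; $[f(\bar{\mathbf x}_{\mathfrak i})]$ is the jump across $\mathfrak i\in\mathcal I_{\mathrm{in}}$ (with a fixed orientation of each edge). **Projections.** For $\mathfrak i\in\mathcal I_{\mathrm{in}}$ the $4M$ vectors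 $\xi_C^{(k)}$ ($C\in\mathcal C$ adjacent to $\mathfrak i$, $k\in\mathcal V_{C,\mathfrak i}$) form a basis of $\mathbb R^{4M}$. Orthogonalize those with $k\in\mathcal V_{\delta,C,\mathfrak i}$ by QR, giving $(\chi_{\mathfrak i}^{(k)})_{k\in\mathcal V_{\delta,\mathfrak i}}$, and let the remaining $\chi_{\mathfrak i}^{(k)}$ be the unselected $\xi_C^{(k)}$; all are normalized to sup norm $1$. For $v\in\mathbb R^{4M}$, $\mathcal P_{\delta,\mathfrak i}^k v$ is the coefficient of $\chi_{\mathfrak i}^{(k)}$ in the expansion of $v$ in the basis $(\chi_{\mathfrak i}^{(k)})$. For $\mathfrak i\in\mathcal I_{\mathrm b}$, $\mathcal P_{\delta,\mathfrak i}^k$ is defined in the same way on $\mathbb R^{2M}$, using only the $2M$ inflow components (those $m$ with $\mathbf n\cdot(c_m,s_m)<0$, $\mathbf n$ the outward normal) of all vectors. **Solution spaces.** $\mathcal F_\delta^{(0)}=\mathcal F_\delta$ and, for $1\le l\le L$, $$\mathcal F_\delta^{(l)}=\{f\in\mathcal F_\delta^{(l-1)}:\ \mathcal P_{\delta,\mathfrak i}^k[f(\bar{\mathbf x}_{\mathfrak i})]=0\ \ \forall\mathfrak i\in\mathcal I_{\mathrm{in}}^{(l-1)}\setminus\mathcal I_{\mathrm{in}}^{(l)},\ \forall k\in\mathcal V_{\delta,\mathfrak i}\},$$ $$\mathcal G_\delta^{(l)}=\{f\in\mathcal F_\delta^{(l-1)}:\ \mathcal P_{\delta,\mathfrak i}^k(f(\bar{\mathbf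 x}_{\mathfrak i})|_C)=0\ \ \forall C\in\mathcal C^{(l)},\ \forall\mathfrak i\in\mathcal I^{(l)}\cap C,\ \forall k\in\mathcal V_{\delta,C,\mathfrak i}\}.$$ **Data vectors.** For $f\in\mathcal F_\delta$: $\mathbf f_{\mathcal C^{(l)}}=\big(\mathcal P_{\delta,\mathfrak i}^k(f(\bar{\mathbf x}_{\mathfrak i})|_C)\big)_{C\in\mathcal C^{(l)},\,\mathfrak i\in\mathcal I\cap\partial C,\,k\in\mathcal V_{\delta,C,\mathfrak i}}$; $\mathbf f_{\mathcal C^{(l)},\mathrm b}$ is its subvector with $\mathfrak i\in\mathcal I_{\mathrm b}$; for a set $\mathcal I_{\mathrm{sub}}$ of interior edges, $[\mathbf f]_{\mathcal I_{\mathrm{sub}}}=\big(\mathcal P_{\delta,\mathfrak i}^k[f(\bar{\mathbf x}_{\mathfrak i})]\big)_{\mathfrak i\in\mathcal I_{\mathrm{sub}},\,k\in\mathcal V_{\delta,\mathfrak i}}$. **Operators (linear maps).** - $B_\delta^{(l)}$ ($0\le l\le L$): for $f\in\mathcal F_\delta^{(l)}$, maps $\mathbf f_{\mathcal C^{(l)}}$ to $(\mathbf f_{\mathcal C^{(l)},\mathrm b}^T,[\mathbf f]_{\mathcal I_{\mathrm{in}}^{(l)}}^T)^T$. It is taken to be a bijection (this is supported by numerical results). - $P_\delta^{(l)}$ ($0\le l\le L-1$): for $f\in\mathcal F_\delta^{(l+1)}$, maps $\mathbf f_{\mathcal C^{(l+1)}}$ to $\mathbf f_{\mathcal C^{(l)}}$.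 - $Q_\delta^{(l)}$ ($0\le l\le L-1$): for $f\in\mathcal G_\delta^{(l+1)}$, maps $[\mathbf f]_{\mathcal I^{(l)}\setminus\mathcal I^{(l+1)}}$ to $\mathbf f_{\mathcal C^{(l)}}$. - $R_\delta^{(l)}$, $\check R_\delta^{(l)}$ ($0\le l\le L-1$): for $f\in\mathcal F_\delta^{(l)}$, they map $(\mathbf f_{\mathcal C^{(l)},\mathrm b}^T,[\mathbf f]_{\mathcal I_{\mathrm{in}}^{(l)}}^T)^T$ to $(\mathbf f_{\mathcal C^{(l+1)},\mathrm b}^T,[\mathbf f]_{\mathcal I_{\mathrm{in}}^{(l+1)}}^T)^T$ and to $[\mathbf f]_{\mathcal I_{\mathrm{in}}^{(l)}\setminus\mathcal I_{\mathrm{in}}^{(l+1)}}$, respectively. **Meaning of the product $B_\delta^{(l+1)}Q_\delta^{(l)}$.** Here $B_\delta^{(l+1)}$ is applied to the vector $\mathbf f_{\mathcal C^{(l)}}$ of a function $f\in\mathcal G_\delta^{(l+1)}$, and $B_\delta^{(l+1)}\mathbf f_{\mathcal C^{(l)}}$ denotes the level-$(l+1)$ boundary and jump data $(\mathbf f_{\mathcal C^{(l+1)},\mathrm b}^T,[\mathbf f]_{\mathcal I_{\mathrm{in}}^{(l+1)}}^T)^T$ of $f$. *)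

(* Defs.v *)
From mathcomp Require Import all_boot all_order all_algebra.
From mathcomp Require Import all_classical all_reals all_analysis.
Import numFieldNormedType.Exports.
Import Order.TTheory GRing.Theory Num.Theory.

Set Implicit Arguments.
Unset Strict Implicit.
Unset Printing Implicit Defensive.

Local Open Scope ring_scope.

(* Lengths are measured in units of h = 1/I, so that cells and edges have
   natural number coordinates.  L is the number of coarsenings and J = I^(L). *)
Section Mesh.
Variables L J : nat.

Definition nfine : nat := (2 ^ L * J)%N.

Definition cell (l : nat) : finType :=
  ('I_(nfine %/ 2 ^ l) * 'I_(nfine %/ 2 ^ l))%type.

(* (d, p, q): if d is true, the vertical edge {p h} x [q h, (q+1) h];
   otherwise the horizontal edge [q h, (q+1) h] x {p h}. *)
Definition edge : finType := (bool * 'I_nfine.+1 * 'I_nfine)%type.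

Definition edir (i : edge) : bool := i.1.1.
Definition epos (i : edge) : nat := i.1.2.
Definition elong (i : edge) : nat := i.2.

(* For each direction d of edges: coordinates of a level-l cell across and
   along the edges of direction d, i.e. C = [2^l a h, 2^l (a+1) h] across. *)
Definition across l (d : bool) (C : cell l) : nat := if d then C.1 else C.2.
Definition along l (d : bool) (C : cell l) : nat := if d then C.2 else C.1.

Definition subcell l (C0 : cell 0) (C : cell l) : bool :=
  (C0.1 %/ 2 ^ l == C.1)%N && (C0.2 %/ 2 ^ l == C.2)%N.

Definition beside l (C : cell l) (i : edge) : bool :=
  (2 ^ l * along (edir i) C <= elong i < 2 ^ l * (along (edir i) C).+1)%N.

Definition edge_in l (C : cell l) (i : edge) : bool :=
  beside C i &&
  (2 ^ l * across (edir i) C <= epos i <= 2 ^ l * (across (edir i) C).+1)%N.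

Definition lower_side l (C : cell l) (i : edge) : bool :=
  (epos i == 2 ^ l * across (edir i) C)%N.
Definition upper_side l (C : cell l) (i : edge) : bool :=
  (epos i == 2 ^ l * (across (edir i) C).+1)%N.

Definition on_boundary l (C : cell l) (i : edge) : bool :=
  beside C i && (lower_side C i || upper_side C i).

Definition edges (l : nat) : {set edge} :=
  [set i : edge | [exists C : cell l, on_boundary C i]]%SET.
Definition edges_b (l : nat) : {set edge} :=
  [set i in edges l | (epos i == 0)%N || (epos i == nfine)]%SET.
Definition edges_in (l : nat) : {set edge} := (edges l :\: edges_b l)%SET.

End Mesh.

Record transport (R : realType) := Transport {
  depth : nat;   (* L *)
  coarse : nat;  (* I^(L) *)
  ndir : nat;    (* M *)
  dirx : 'rV[R]_(4 * ndir);
  diry : 'rV[R]_(4 * ndir);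
  weight : 'rV[R]_(4 * ndir);
  scat : 'M[R]_(4 * ndir);
  sigmaT : R * R -> R;
  sigmaA : R * R -> R;
  eps : R;
  delta : R;
  (* true if the jump is the upper value minus the lower one *)
  orient : edge depth coarse -> bool
}.

Section Data.
Variables (R : realType) (T : transport R).

Notation L := (depth T).
Notation J := (coarse T).
Notation M := (ndir T).
Notation cell := (cell L J).
Notation edge := (edge L J).

Definition width : R := (nfine L J)%:R^-1.

Notation h := width.

Definition cell_region (C : cell 0) : set (R * R) :=
  [set z : R * R | C.1%:R * h <= z.1 <= C.1.+1%:R * h /\
                   C.2%:R * h <= z.2 <= C.2.+1%:R * h]%classic.

Definition cell_average (g : R * R -> R) (C : cell 0) : R :=
  (h ^+ 2)^-1 *
  \int[(@lebesgue_measure R \x @lebesgue_measure R)%E]_(z in cell_region C) g z.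

Definition sigma_tot (C : cell 0) : R := cell_average (sigmaT T) C / eps T.
Definition sigma_sc (C : cell 0) : R :=
  cell_average (sigmaT T) C / eps T - eps T * cell_average (sigmaA T) C.

Definition well_posed : Prop :=
  [/\ (0 < J)%N, 0 < eps T <= 1, 0 < delta T,
      [/\ forall m, dirx T 0 m != 0, forall m, diry T 0 m != 0 &
          forall a b : bool,
            #|[set m | (0 < dirx T 0 m) == a & (0 < diry T 0 m) == b]%SET| = M] &
      forall g, g = sigmaT T \/ g = sigmaA T ->
        (@lebesgue_measure R \x @lebesgue_measure R)%E.-integrable
          [set z : R * R | 0 <= z.1 <= 1 /\ 0 <= z.2 <= 1]%classic (EFin \o g)].

(* The outward normal, if i is on the boundary of the domain. *)
Definition outward (i : edge) : R * R :=
  let s : R := if epos i == 0%N then -1 else 1 in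
  if edir i then (s, 0) else (0, s).

(* The components of a vector of R^(4M) that are used on the edge i: the inflow
   ones if i is on the boundary of the domain, and all of them otherwise. *)
Definition comps (i : edge) : {set 'I_(4 * M)} :=
  [set m | (i \in edges_b L J 0) ==>
     ((outward i).1 * dirx T 0 m + (outward i).2 * diry T 0 m < 0)]%SET.

Definition mode_mx (C : cell 0) (d : bool) : 'M[R]_(4 * M) :=
  invmx (diag_mx (if d then dirx T else diry T)) *m
  ((sigma_sc C / sigma_tot C) *: (scat T *m diag_mx (weight T)) - 1%:M).

End Data.

(* Modes of different cells are distinct: an index is a pair (C, k).  In 'I_(8M)
   the indices are numbered from 0: k stands for k + 1 in 1, ..., 8M. *)
Definition mode_index (R : realType) (T : transport R) : finType :=
  (cell (depth T) (coarse T) 0 * 'I_(8 * ndir T))%type.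

Record scheme (R : realType) := Scheme {
  problem :> transport R;
  lam : cell (depth problem) (coarse problem) 0 -> 'I_(8 * ndir problem) -> R;
  xi : cell (depth problem) (coarse problem) 0 -> 'I_(8 * ndir problem) ->
       'cV[R]_(4 * ndir problem);
  chi : forall i : edge (depth problem) (coarse problem),
        mode_index problem -> 'cV[R]_#|comps i|
}.

Section Scheme.
Variables (R : realType) (T : scheme R).

Notation L := (depth T).
Notation J := (coarse T).
Notation M := (ndir T).
Notation cell := (cell L J).
Notation edge := (edge L J).
Notation mode := 'I_(8 * M).
Notation mode_index := (mode_index T).
Notation h := (width T).
Notation sigma_tot := (@sigma_tot R T).
Notation lam := (@lam R T).
Notation xi := (@xi R T).
Notation chi := (@chi R T).

(* The mode depends on x only, and is centered on a vertical side. *)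
Definition mdir (k : mode) : bool := (k < 4 * M)%N.
(* The mode is centered on the right or top side. *)
Definition mupper (k : mode) : bool := (2 * M <= k %% (4 * M))%N.

(* For each direction, the 4M eigenpairs form a complete system. *)
Definition eigenpairs : Prop :=
  forall C : cell 0,
  [/\ forall k, mode_mx C (mdir k) *m xi C k = lam C k *: xi C k,
      forall d, free [seq xi C k | k <- enum 'I_(8 * M) & mdir k == d],
      forall k, mx_norm (xi C k) = 1 &
      forall k, if mupper k then 0 < lam C k * sigma_tot C
                else lam C k * sigma_tot C < 0].

(* Values on the mesh lines play no role and are set to 0. *)
Definition phi (C : cell 0) (k : mode) (z : R * R) : 'cV[R]_(4 * M) :=
  if (C.1%:R * h < z.1 < C.1.+1%:R * h) && (C.2%:R * h < z.2 < C.2.+1%:R * h)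
  then expR (lam C k * sigma_tot C * ((if mdir k then z.1 else z.2)
                                 - (across (mdir k) C + mupper k)%:R * h))
       *: xi C k
  else 0.

Definition midcell (C : cell 0) : R * R :=
  ((C.1%:R + 2^-1) * h, (C.2%:R + 2^-1) * h).

Definition centered (i : edge) (ck : mode_index) : bool :=
  [&& edir i == mdir ck.2, elong i == along (edir i) ck.1 &
      epos i == across (edir i) ck.1 + mupper ck.2]%N.

Definition sel_cell (C : cell 0) : {set mode} :=
  [set k | delta T < mx_norm (phi C k (midcell C))]%SET.

Definition sel_edge (i : edge) : {set mode_index} :=
  [set ck : mode_index | centered i ck & ck.2 \in sel_cell ck.1]%SET.

Definition sel_in l (C : cell l) (i : edge) : {set mode_index} :=
  [set ck in sel_edge i | subcell ck.1 C]%SET.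

Definition func : Type := R * R -> 'cV[R]_(4 * M).

Definition span_sel : set func :=
  [set f | exists a : cell 0 -> mode -> R, f = fun z =>
     \sum_(C : cell 0) \sum_(k in sel_cell C) a C k *: phi C k z]%classic.

Definition restr (i : edge) (v : 'cV[R]_(4 * M)) : 'cV[R]_#|comps i| :=
  rowsub (fun j : 'I_#|comps i| => enum_val j) v.

Definition modes_at (i : edge) : {set mode_index} := [set ck | centered i ck]%SET.

Definition xi_basis : Prop := forall i : edge,
  basis_of fullv [seq restr i (xi ck.1 ck.2) | ck <- enum (modes_at i)].

(* The order s in which the selected vectors are orthogonalized, and the sign
   of the columns of Q, are left free. *)
Definition qr_selected (i : edge) : Prop :=
  exists (s : 'I_#|sel_edge i| -> mode_index)
         (Q : 'M[R]_(#|comps i|, #|sel_edge i|)) (U : 'M[R]_#|sel_edge i|),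
  [/\ injective s /\ (forall j, s j \in sel_edge i),
      (\matrix_(m, j) restr i (xi (s j).1 (s j).2) m 0) = Q *m U,
      Q^T *m Q = 1%:M, (forall j j' : 'I_#|sel_edge i|, (j' < j)%N -> U j j' = 0) &
      forall j, chi i (s j) = (mx_norm (col j Q))^-1 *: col j Q].

Definition edge_bases : Prop := forall i : edge,
  qr_selected i /\
  (forall ck, ck \in modes_at i :\: sel_edge i ->
     chi i ck = (mx_norm (restr i (xi ck.1 ck.2)))^-1
                *: restr i (xi ck.1 ck.2)).

(* Coefficient of chi i ck in the basis (chi i ck'), ck' \in modes_at i. *)
Definition edge_proj (i : edge) (ck : mode_index) (v : 'cV[R]_(4 * M)) : R :=
  if [pick j : 'I_#|modes_at i| | enum_val j == ck] is Some j
  then coord [tuple chi i (enum_val j') | j' < #|modes_at i|] j (restr i v)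
  else 0.

Definition midpoint (i : edge) : R * R :=
  let a := (epos i)%:R * h in let b := ((elong i)%:R + 2^-1) * h in
  if edir i then (a, b) else (b, a).

(* One-sided value at the midpoint of i, from the side of increasing
   coordinate if u is true, and from the other side otherwise. *)
Definition side_value (f : func) (i : edge) (u : bool) : 'cV[R]_(4 * M) :=
  let sg : R := if u then 1 else -1 in
  \col_m lim ((fun t : R =>
     f (if edir i then ((midpoint i).1 + sg * t, (midpoint i).2)
        else ((midpoint i).1, (midpoint i).2 + sg * t)) m 0) @ 0^'+)%classic.

Definition value_in l (f : func) (C : cell l) (i : edge) : 'cV[R]_(4 * M) :=
  side_value f i (lower_side C i).

Definition jump (f : func) (i : edge) : 'cV[R]_(4 * M) :=
  if orient i then side_value f i true - side_value f i false
  else side_value f i false - side_value f i true.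

(* As boundary edges belong to all levels, this is also I^(l) \ I^(l+1). *)
Definition new_edges l : {set edge} := (edges_in L J l :\: edges_in L J l.+1)%SET.

Fixpoint F_space (l : nat) : set func :=
  if l is l'.+1 then
    [set f | F_space l' f /\
       forall i, i \in new_edges l' ->
       forall ck, ck \in sel_edge i -> edge_proj i ck (jump f i) = 0]%classic
  else span_sel.

(* Only meant for l >= 1. *)
Definition G_space (l : nat) : set func :=
  [set f | F_space l.-1 f /\
     forall (C : cell l) i, i \in edges L J l -> edge_in C i ->
     forall ck, ck \in sel_in C i -> edge_proj i ck (value_in f C i) = 0]%classic.

Definition cell_index l : {set cell l * edge * mode_index} :=
  [set t : cell l * edge * mode_index |
     on_boundary t.1.1 t.1.2 & t.2 \in sel_in t.1.1 t.1.2]%SET.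
Definition bdry_index l : {set cell l * edge * mode_index} :=
  [set t in cell_index l | t.1.2 \in edges_b L J 0]%SET.
Definition jump_index (E : {set edge}) : {set edge * mode_index} :=
  [set t : edge * mode_index | t.1 \in E & t.2 \in sel_edge t.1]%SET.

Definition vec (I : finType) (A : {set I}) := {ffun {t : I | t \in A} -> R^o}.

Definition cell_vec l (f : func) : vec (cell_index l) :=
  [ffun t => let: (C, i, ck) := val t in edge_proj i ck (value_in f C i)].
Definition bdry_vec l (f : func) : vec (bdry_index l) :=
  [ffun t => let: (C, i, ck) := val t in edge_proj i ck (value_in f C i)].
Definition jump_vec (E : {set edge}) (f : func) : vec (jump_index E) :=
  [ffun t => let: (i, ck) := val t in edge_proj i ck (jump f i)].

Definition data_space l : vectType R :=
  (vec (bdry_index l) * vec (jump_index (edges_in L J l)))%type.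
Definition data_vec l (f : func) : data_space l :=
  (bdry_vec l f, jump_vec (edges_in L J l) f).

End Scheme.

Arguments F_space {R} T l _.
Arguments G_space {R} T l _.

(* A sends u(f) to v(f) for all f in X. *)
Definition sends (F : Type) (U V : Type) (X : set F) (u : F -> U) (v : F -> V)
  (A : U -> V) : Prop := forall f, X f -> A (u f) = v f.

(* Main.v *)
From HB Require Import structures.
Require Import Defs.
From mathcomp Require Import all_boot all_order all_algebra.
From mathcomp Require Import all_classical all_reals all_analysis.
From mathcomp Require Import zify.
Import numFieldNormedType.Exports.
Import Order.TTheory GRing.Theory Num.Theory.
Local Open Scope ring_scope.

(** Let f in F^(l) have the boundary and jump data w.  If g in G^(l+1) has the
    same jumps as f across the edges that disappear at level l+1, then f - g
    lies in F^(l+1), its level-(l+1) data are those of f minus those of g,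
    namely (R - B Q Rcheck) w, and therefore its level-l cell data are
    P B^-1 (R - B Q Rcheck) w.  Adding the cell data Q Rcheck w of g gives those
    of f, which are B^-1 w.

    Three points have to be justified.

    - B^-1 is the inverse of B on the whole space of cell vectors, and every
      cell vector comes from a function of F^(l).  B^(l) is only given as a
      bijection from the cell data of F^(l) onto the space of boundary and jump
      data, but cell vectors have at most as many entries as boundary and jump
      data ([card_cell_index]), so that a surjective B^(l) is injective
      ([lker_bij]).

    - The function g exists.  A vector x on the edges of level l that are not of
      level l+1 extends by 0 to a level-l cell vector E x ([extend_new]), which
      is the cell vector of some f in F^(l); since it vanishes on the edges
      of level l+1, f is in G^(l+1).  So Q maps the new jumps
      Rcheck (B (E x)) of f back to E x.  Hence Rcheck B E is an injective
      endomorphism of the space of new jumps, and it is onto.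

    - Data of consecutive levels agree on the edges they share.  This is because
      a selected mode of a fine cell that is centered on an edge determines
      the side of the edge on which its ancestors of all levels lie: the
      entry of index (C, i, k) depends only on i and k ([cell_vecE]).

    Instead of f - g, the proof uses a function e of F^(l+1) that has the same
    level-(l+1) data as f - g should have.  Comparing the level-l data of e, g
    and f entry by entry ([data_vec_split]) then needs no linearity of the
    one-sided limits that define these data. *)

Set Implicit Arguments.
Unset Strict Implicit.

(** * Injectivity and surjectivity in finite dimension *)

Lemma surj_lker0 (K : fieldType) (U V : vectType K) (f : 'Hom(U, V)) :
  (\dim {:U} <= \dim {:V})%N -> (forall v, exists u, f u = v) ->
  lker f == 0%VS.
Proof.
move=> dUV fsurj; have fV : limg f = fullv.
  apply/eqP; rewrite eqEsubv subvf; apply/subvP => v _.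
  by have [u <-] := fsurj v; rewrite memv_img ?memvf.
rewrite -dimv_eq0 -leqn0 -(leq_add2r (\dim (limg f))) add0n.
by rewrite -{1}(capfv (lker f)) limg_ker_dim fV.
Qed.

Lemma lker0_surj (K : fieldType) (U : vectType K) (f : 'End(U)) :
  lker f == 0%VS -> forall v, exists u, f u = v.
Proof. by move=> f0 v; exists (f^-1%VF v); rewrite lker0_lfunVK. Qed.

(** * Dimensions of the data spaces *)

Lemma dim_vec (R : realType) (I : finType) (A : {set I}) :
  \dim {:vec R A} = #|A|.
Proof. by rewrite dimvf /dim /= muln1 card_sig; apply: eq_card. Qed.

Lemma dim_data_space (R : realType) (T : scheme R) l :
  \dim {:data_space T l} =
  (#|bdry_index T l| + #|jump_index (T := T) (edges_in _ _ l)|)%N.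
Proof.
by rewrite -(dim_vec R (bdry_index T l)) -(dim_vec R (jump_index _)) !dimvf.
Qed.

(** * Edges of the mesh hierarchy *)

(** On a fine mesh whose size is a multiple of 2^l, an edge lies between two
    level-l cells, or between one and the outside, as soon as it is on one of
    their grid lines.  All inclusions between sets of edges follow from this
    divisibility criterion. *)
Lemma mem_edgesE L J l (i : edge L J) : (l <= L)%N ->
  (i \in edges L J l) = (2 ^ l %| epos i)%N.
Proof.
move=> lL; rewrite inE; apply/existsP/idP.
  by case=> C /andP[_ /orP[]/eqP->]; apply: dvdn_mulr.
have m0 : (0 < 2 ^ l)%N by rewrite expn_gt0.
case/dvdnP=> q iq; set n := (nfine L J %/ 2 ^ l)%N.
have nE : nfine L J = (n * 2 ^ l)%N.
  by rewrite divnK // /nfine dvdn_mulr // dvdn_exp2l.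
have bn : (elong i %/ 2 ^ l < n)%N.
  by rewrite ltn_divLR // -nE /elong ltn_ord.
have qn : (q <= n)%N.
  by rewrite -(leq_pmul2r m0) -iq -nE /epos -ltnS ltn_ord.
have n0 : (0 < n)%N by apply: leq_ltn_trans bn.
(* On the last grid line only the cell before it exists. *)
have an : (q - (q == n) < n)%N.
  case: eqP => [->|/eqP q_n]; first by rewrite subn1 prednK.
  by rewrite subn0 ltn_neqAle q_n.
exists (if edir i then (Ordinal an, Ordinal bn) else (Ordinal bn, Ordinal an)).
have b_lo : (2 ^ l * (elong i %/ 2 ^ l) <= elong i)%N by rewrite mulnC leq_divM.
have b_hi : (elong i < 2 ^ l * (elong i %/ 2 ^ l).+1)%N.
  by rewrite mulnC -ltn_divLR.
have side : (epos i == 2 ^ l * (q - (q == n)))%N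
         || (epos i == 2 ^ l * (q - (q == n)).+1)%N.
  rewrite iq !(mulnC (2 ^ l)%N) !eqn_pmul2r //.
  case: (q =P n) => [->|_]; last by rewrite subn0 eqxx.
  by rewrite subn1 prednK // eqxx orbT.
rewrite /on_boundary /beside /lower_side /upper_side /along /across.
by case: (edir i) => /=; rewrite b_lo b_hi side.
Qed.

Lemma edges_coarsen L J l (i : edge L J) :
  (l < L)%N -> i \in edges L J l.+1 -> i \in edges L J l.
Proof.
move=> lL; rewrite !mem_edgesE ?(ltnW lL) //.
by apply: dvdn_trans; rewrite dvdn_exp2l.
Qed.

(** Both sides of the domain are grid lines of every level, so that boundary
    edges are never removed. *)
Lemma mem_edges_bE L J l (i : edge L J) : (l <= L)%N ->
  (i \in edges_b L J l) = (epos i == 0%N) || (epos i == nfine L J).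
Proof.
move=> lL; rewrite finset.in_set mem_edgesE //; apply: andb_idl.
by case/orP=> /eqP->; rewrite ?dvdn0 // dvdn_mulr // dvdn_exp2l.
Qed.

Lemma mem_new_edgesE (R : realType) (T : scheme R) l i : (l < depth T)%N ->
  i \in edges_in (depth T) (coarse T) l ->
  (i \in new_edges T l) = (i \notin edges (depth T) (coarse T) l.+1).
Proof.
move=> lL; rewrite !finset.in_setD !mem_edges_bE ?(ltnW lL) //.
by case/andP=> -> -> /=; rewrite andbT.
Qed.

(** * Modes centered on an edge *)

Lemma sel_edge_pos (R : realType) (T : scheme R) i ck :
  ck \in sel_edge (T := T) i ->
  [/\ elong i = along (edir i) ck.1 &
      epos i = (across (edir i) ck.1 + mupper ck.2)%N].
Proof.
by rewrite finset.in_set => /andP[/and3P[/eqP-> /eqP-> /eqP->] _].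
Qed.

Lemma subcell_pos L J l (C0 : cell L J 0) (C : cell L J l) d :
  subcell C0 C -> (across d C0 %/ 2 ^ l = across d C)%N /\
                  (along d C0 %/ 2 ^ l = along d C)%N.
Proof. by case/andP=> /eqP e1 /eqP e2; case: d. Qed.

Lemma subcell_inj L J l (C0 : cell L J 0) (C C' : cell L J l) :
  subcell C0 C -> subcell C0 C' -> C = C'.
Proof.
case: C C' => [a b] [a' b'] /andP[/eqP e1 /eqP e2] /andP[/eqP e1' /eqP e2'].
by congr pair; apply: val_inj => /=; rewrite -?e1 -?e2.
Qed.

(** The fine cell of the mode is contained in C, so that both are on the same side
    of the edge, and the centering of the mode tells which one. *)
Lemma sel_in_side (R : realType) (T : scheme R) l
    (C : cell (depth T) (coarse T) l) i ck :
  on_boundary C i -> ck \in sel_in (T := T) C i ->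
  lower_side C i = ~~ mupper ck.2.
Proof.
case/andP=> _ side; rewrite finset.in_set => /andP[/sel_edge_pos[_ pi]].
case/(subcell_pos (edir i)) => aC _.
move: side; rewrite /lower_side /upper_side -aC pi.
have m0 : (0 < 2 ^ l)%N by rewrite expn_gt0.
have := divn_eq (across (edir i) ck.1) (2 ^ l).
have := ltn_pmod (across (edir i) ck.1) m0.
move: (_ %/ _)%N (_ %% _)%N => q r.
by case: (mupper ck.2) => /= ? ? side; apply/eqP; nia.
Qed.

(** The witness is the level-l ancestor of the fine cell of the mode.  It contains
    the edge, which cannot be in its interior because it is on a grid line of
    level l. *)
Lemma sel_in_exists (R : realType) (T : scheme R) l i ck :
  (l <= depth T)%N -> i \in edges (depth T) (coarse T) l ->
  ck \in sel_edge (T := T) i -> exists C, (C, i, ck) \in cell_index T l.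
Proof.
move=> lL; rewrite mem_edgesE // => dvd_i sel_ck.
have m0 : (0 < 2 ^ l)%N by rewrite expn_gt0.
have bnd (a : 'I_(nfine (depth T) (coarse T) %/ 2 ^ 0)) :
    (a %/ 2 ^ l < nfine (depth T) (coarse T) %/ 2 ^ l)%N.
  rewrite ltn_divLR // divnK ?(leq_trans (ltn_ord a)) ?divn1 //.
  by rewrite dvdn_mulr // dvdn_exp2l.
pose C : cell (depth T) (coarse T) l :=
  (Ordinal (bnd ck.1.1), Ordinal (bnd ck.1.2)).
have sub : subcell ck.1 C by rewrite /subcell /= !eqxx.
exists C; rewrite finset.in_set /= (finset.in_set _ _) sel_ck sub !andbT.
have [li pi] := sel_edge_pos sel_ck.
have [aC lC] := subcell_pos (edir i) sub.
rewrite /on_boundary /beside /lower_side /upper_side -aC -lC -li.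
rewrite mulnC leq_divM mulnC -ltn_divLR //= ltnS leqnn /=.
case/dvdnP: dvd_i => q; rewrite pi.
have := divn_eq (across (edir i) ck.1) (2 ^ l).
have := ltn_pmod (across (edir i) ck.1) m0.
move: (_ %/ _)%N (_ %% _)%N => b r rm ->.
case: (mupper ck.2) => /= eq_q; apply/orP; [right|left]; rewrite eq_q.
  have qb : (b < q)%N by rewrite -(ltn_pmul2r m0); lia.
  have bq : (q <= b.+1)%N by rewrite -(leq_pmul2r m0) mulSn; lia.
  by rewrite mulnC (_ : q = b.+1) //; apply/eqP; rewrite eqn_leq bq.
have qb : (b <= q)%N by rewrite -(leq_pmul2r m0); lia.
have bq : (q < b.+1)%N by rewrite -(ltn_pmul2r m0) mulSn; lia.
by rewrite mulnC (_ : q = b) //; apply/eqP; rewrite eqn_leq qb -ltnS bq.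
Qed.

(** * Comparison of the data of different levels *)

(** The one-sided value is taken in the fine cell that carries the mode, hence
    the common value of the entries (C, i, ck) of all levels. *)
Definition own_coef (R : realType) (T : scheme R) (f : func T) i ck : R :=
  edge_proj i ck (side_value f i (~~ mupper ck.2)).

Lemma value_in_own (R : realType) (T : scheme R) (f : func T) l
    (C : cell (depth T) (coarse T) l) i ck :
  on_boundary C i -> ck \in sel_in (T := T) C i ->
  edge_proj i ck (value_in f C i) = own_coef f i ck.
Proof. by move=> bC sC; rewrite /value_in (sel_in_side bC sC). Qed.

Lemma cell_vecE (R : realType) (T : scheme R) l (f : func T) t :
  cell_vec l f t = own_coef f (val t).1.2 (val t).2.
Proof.
case: t => [[[C i] ck] tP]; rewrite ffunE /=.
by move: (tP); rewrite finset.in_set => /andP[/value_in_own]; apply.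
Qed.

Lemma bdry_vecE (R : realType) (T : scheme R) l (f : func T) t :
  bdry_vec l f t = own_coef f (val t).1.2 (val t).2.
Proof.
case: t => [[[C i] ck] tP]; rewrite ffunE /=.
by move: (tP); rewrite 2!finset.in_set => /andP[/andP[/value_in_own own /own]].
Qed.

(** No grid line of level l crosses the interior of a level-l cell. *)
Lemma edge_in_boundary L J l (C : cell L J l) i : (l <= L)%N ->
  i \in edges L J l -> edge_in C i -> on_boundary C i.
Proof.
move=> lL; rewrite mem_edgesE // => /dvdnP[q iq] /andP[bC].
rewrite /on_boundary /lower_side /upper_side bC iq (mulnC q) /=.
rewrite !leq_pmul2l ?expn_gt0 // !eqn_pmul2l ?expn_gt0 // => /andP[].
by rewrite [(_ <= _.+1)%N]leq_eqVlt ltnS => lo /orP[->|hi];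
  rewrite ?orbT // eqn_leq lo hi.
Qed.

(** An entry (C, i, ck) is determined by (i, ck), because C is the ancestor of
    the fine cell of ck.  It is a boundary entry if i is on the boundary, and
    otherwise it is counted by the jump at (i, ck). *)
Lemma card_cell_index (R : realType) (T : scheme R) l : (l <= depth T)%N ->
  (#|cell_index T l| <=
   #|bdry_index T l| + #|jump_index (T := T) (edges_in _ _ l)|)%N.
Proof.
move=> lL; rewrite -(cardsID [set t | t.1.2 \in edges_b _ _ 0]%SET).
apply: leq_add.
  by apply: subset_leq_card; apply/fintype.subsetP => t; rewrite !finset.in_set.
have inj : {in (cell_index T l :\: [set t | t.1.2 \in edges_b _ _ 0])%SET &,
    injective (fun t => (t.1.2, t.2))}.
  move=> [[C i] ck] [[C' i'] ck'].
  move=> /finset.setDP[tP _] /finset.setDP[tP' _] /= [ei eck].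
  subst i' ck'; move: tP; rewrite 2!finset.in_set => /andP[_ /andP[_ s1]].
  move: tP'; rewrite 2!finset.in_set => /andP[_ /andP[_ s2]].
  by have /= -> := subcell_inj s1 s2.
rewrite -(card_in_imset inj); apply: subset_leq_card.
apply/fintype.subsetP => u.
case/imsetP=> [[[C i] ck] /finset.setDP[tP]] + -> {u}.
rewrite finset.in_set /= mem_edges_bE // => ib.
move: tP; rewrite 2!finset.in_set => /andP[/= bC /andP[sel _]].
rewrite finset.in_set /= sel andbT finset.in_setD mem_edges_bE // ib /=.
by rewrite finset.in_set; apply/existsP; exists C.
Qed.

(** Bijectivity on the cell data of functions of F^(l) extends to all cell
    vectors: the map is onto, and the dimensions leave no room for a kernel. *)
Lemma lker_bij (R : realType) (T : scheme R) l
    (B : 'Hom(vec R (cell_index T l), data_space T l)) :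
  (l <= depth T)%N ->
  set_bij [set cell_vec l f | f in F_space T l]%classic setT B ->
  lker B == 0%VS.
Proof.
move=> lL [_ _ Bsurj]; apply: surj_lker0.
  by rewrite dim_data_space dim_vec card_cell_index.
by move=> w; have [v _ <-] := Bsurj w I; exists v.
Qed.

(** Extension by 0 of a vector on the new edges; the cell of an entry is
    forgotten.  It is injective because every selected mode at a new edge occurs in some
    level-l entry. *)
Lemma extend_new (R : realType) (T : scheme R) l (lL : (l < depth T)%N) :
  exists E : 'Hom(vec R (jump_index (new_edges T l)), vec R (cell_index T l)),
  injective E /\
  forall x t, (val t).1.2 \notin new_edges T l -> E x t = 0.
Proof.
pose e (x : vec R (jump_index (new_edges T l))) : vec R (cell_index T l) :=
  [ffun t => oapp x 0 (insub ((val t).1.2, (val t).2))].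
have e_lin : linear e.
  move=> a x y; apply/ffunP => t; rewrite !ffunE.
  by case: insubP => [u _ _|_] /=; rewrite ?ffunE // scaler0 addr0.
pose elin := GRing.isLinear.Build _ _ _ _ e e_lin.
pose E : {linear _ -> _} := HB.pack e elin.
exists (linfun E); split=> [x y|x t tn].
  rewrite !lfunE /= => exy; apply/ffunP => u.
  have := valP u; rewrite finset.in_set => /andP[iN sel].
  have iE : (val u).1 \in edges (depth T) (coarse T) l.
    by move: iN; rewrite !finset.in_setD => /andP[_ /andP[]].
  have [C tC] := sel_in_exists (ltnW lL) iE sel.
  have /ffunP/(_ (exist (fun t => t \in _) _ tC)) := exy; rewrite !ffunE /=.
  by rewrite -surjective_pairing valK.
rewrite lfunE /= ffunE insubF //; apply: negbTE.
by rewrite finset.in_set negb_and /= tn.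
Qed.

(** Interior edges of level l are either of level l+1, where the level-(l+1) data
    decide, or new, where e has no jump; boundary entries are shared by both
    levels. *)
Lemma data_vec_split (R : realType) (T : scheme R) l (e f g : func T) :
  (l < depth T)%N ->
  data_vec l.+1 e + data_vec l.+1 g = data_vec l.+1 f ->
  jump_vec (new_edges T l) e = 0 ->
  jump_vec (new_edges T l) g = jump_vec (new_edges T l) f ->
  data_vec l e + data_vec l g = data_vec l f.
Proof.
move=> lL [/ffunP eqb /ffunP eqj] /ffunP e0 /ffunP eqn; congr pair; apply/ffunP.
  move=> t; rewrite ffunE !bdry_vecE.
  have := valP t; rewrite finset.in_set => /andP[+ ib].
  rewrite 2!finset.in_set => /andP[_ /andP[sel _]].
  have iE : (val t).1.2 \in edges (depth T) (coarse T) l.+1.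
    have : (val t).1.2 \in edges_b (depth T) (coarse T) l.+1.
      by move: ib; rewrite !mem_edges_bE.
    by rewrite finset.in_set => /andP[].
  have [C tC] := sel_in_exists lL iE sel.
  have tb : (C, (val t).1.2, (val t).2) \in bdry_index T l.+1.
    by rewrite finset.in_set tC.
  by have := eqb (exist (fun t => t \in _) _ tb); rewrite ffunE !bdry_vecE.
move=> t; have := valP t; rewrite finset.in_set => /andP[iN sel].
case: (boolP ((val t).1 \in edges_in (depth T) (coarse T) l.+1)) => iE.
  have tj : val t \in jump_index (T := T) (edges_in _ _ l.+1).
    by rewrite finset.in_set iE.
  by have := eqj (exist (fun t => t \in _) _ tj); rewrite !ffunE /=.
have tn : val t \in jump_index (new_edges T l).
  by rewrite finset.in_set sel andbT finset.in_setD iE iN.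
have := e0 (exist (fun t => t \in _) _ tn).
have := eqn (exist (fun t => t \in _) _ tn); rewrite !ffunE /=.
by case: (val t) => i ck -> ->; rewrite add0r.
Qed.

Unset Implicit Arguments.
Set Strict Implicit.

(** * The recursion for the inverse *)

Theorem lemma3p4 (R : realType) (T : scheme R)
  (hT : well_posed T) (hlamxi : eigenpairs T) (hxi : xi_basis T)
  (hchi : edge_bases T)
  (B : forall l, 'Hom(vec R (cell_index T l), data_space T l))
  (P : forall l, 'Hom(vec R (cell_index T l.+1), vec R (cell_index T l)))
  (Q : forall l, 'Hom(vec R (jump_index (new_edges T l)), vec R (cell_index T l)))
  (Rop : forall l, 'Hom(data_space T l, data_space T l.+1))
  (Rcheck : forall l,
     'Hom(data_space T l, vec R (jump_index (new_edges T l))))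
  (BG : forall l, 'Hom(vec R (cell_index T l), data_space T l.+1))
  (hB : forall l, (l <= depth T)%N ->
     sends (F_space T l) (cell_vec l) (data_vec l) (B l))
  (hBbij : forall l, (l <= depth T)%N ->
     set_bij [set cell_vec l f | f in F_space T l]%classic setT (B l))
  (hP : forall l, (l < depth T)%N ->
     sends (F_space T l.+1) (cell_vec l.+1) (cell_vec l) (P l))
  (hQ : forall l, (l < depth T)%N ->
     sends (G_space T l.+1) (jump_vec (new_edges T l)) (cell_vec l) (Q l))
  (hR : forall l, (l < depth T)%N ->
     sends (F_space T l) (data_vec l) (data_vec l.+1) (Rop l))
  (hRcheck : forall l, (l < depth T)%N ->
     sends (F_space T l) (data_vec l) (jump_vec (new_edges T l)) (Rcheck l))
  (hBG : forall l, (l < depth T)%N ->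
     sends (G_space T l.+1) (cell_vec l) (data_vec l.+1) (BG l)) :
  forall l, (l < depth T)%N ->
    ((B l)^-1 = (P l \o ((B l.+1)^-1
                         \o (Rop l - ((BG l \o Q l) \o Rcheck l))))
                + (Q l \o Rcheck l))%VF.
Proof.
move=> l lL; have lL' := ltnW lL.
have B0 := lker_bij lL' (hBbij l lL').
have B1 := lker_bij lL (hBbij l.+1 lL).
have cell_surj v : exists2 f, F_space T l f & cell_vec l f = v.
  have [_ _ Bsurj] := hBbij l lL'.
  by have [_ [f Ff <-] /(lker0P B0) <-] := Bsurj (B l v) I; exists f.
(* Functions whose cell vector is supported on the new edges are in G^(l+1),
   and Q recovers their cell vector from their jumps on the new edges. *)
have [E [Einj Eout]] := extend_new lL.
have E_G x f : F_space T l f -> cell_vec l f = E x -> G_space T l.+1 f.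
  move=> Ff fx; split=> // C i iE iC ck sC.
  have bC := edge_in_boundary lL iE iC.
  rewrite value_in_own //.
  have iE' := edges_coarsen lL iE.
  have sel : ck \in sel_edge (T := T) i.
    by move: sC; rewrite finset.in_set => /andP[].
  have [C0 tC] := sel_in_exists lL' iE' sel.
  have := cell_vecE f (exist (fun t => t \in _) _ tC); rewrite /= fx => <-.
  apply: Eout; rewrite /=; apply/negP => iN.
  have : i \in edges_in (depth T) (coarse T) l.
    by move: iN; rewrite finset.in_setD => /andP[].
  by move/(mem_new_edgesE lL); rewrite iN iE.
have G_surj r : exists2 g, G_space T l.+1 g & jump_vec (new_edges T l) g = r.
  pose N := (Rcheck l \o (B l \o E))%VF.
  have NE x f : F_space T l f -> cell_vec l f = E x ->
      N x = jump_vec (new_edges T l) f.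
    move=> Ff fx; rewrite /N !comp_lfunE -fx.
    by rewrite (hB l lL' f Ff) (hRcheck l lL f Ff).
  have QN x : Q l (N x) = E x.
    have [f Ff fx] := cell_surj (E x).
    by rewrite (NE x f) // (hQ l lL f (E_G x f Ff fx)).
  have N0 : lker N == 0%VS.
    by apply/lker0P => x y Nxy; apply: Einj; rewrite -!QN Nxy.
  have [x <-] := lker0_surj N0 r.
  have [f Ff fx] := cell_surj (E x).
  by exists f; [apply: E_G fx | rewrite (NE x f)].
apply/lfunP => w; rewrite !lfun_simp.
have [_ [f Ff <-] fw] :
    ([set B l v | v in [set cell_vec l f | f in F_space T l]] w)%classic.
  by have [_ _] := hBbij l lL'; apply.
have wE : w = data_vec l f by rewrite -fw (hB l lL').
have [g Gg gw] := G_surj (jump_vec (new_edges T l) f).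
have Fg : F_space T l g by case: Gg.
rewrite -{1}fw lker0_lfunK // wE (hRcheck l lL f Ff) -gw (hQ l lL g Gg).
rewrite (hBG l lL g Gg) (hR l lL f Ff).
(* e stands for f - g. *)
have [_ [e Fe <-] ed] :
    ([set B l.+1 v | v in [set cell_vec l.+1 f | f in F_space T l.+1]]
    (data_vec l.+1 f - data_vec l.+1 g))%classic.
  by have [_ _] := hBbij l.+1 lL; apply.
rewrite -ed lker0_lfunK // (hP l lL e Fe).
have [Fe' ej] := Fe.
apply: (lker0P B0); rewrite linearD /= !(hB l lL') //; symmetry.
apply: data_vec_split => //.
  by rewrite -(hB l.+1 lL e Fe) ed subrK.
apply/ffunP => t; have := valP t; rewrite !ffunE finset.in_set.
by case: (val t) => i ck /andP[iN /(ej i iN)].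
Qed.
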